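(* There exists a covering system of the integers whose moduli are all odd and greater than $1$, in which exactly three congruences have modulus $9$ and the congruences with moduli different from $9$ have pairwise distinct moduli.
   Context: A covering system is a finite collection of congruences $r_i\pmod{m_i}$ such that every integer satisfies at least one of them. *)

(* Defs.v *)
From mathcomp Require Import all_boot all_order all_algebra.

Set Implicit Arguments.
Unset Strict Implicit.
Unset Printing Implicit Defensive.

(* The pair (r, m) stands for the congruence r (mod m). *)
Definition congruence : Type := (int * nat)%type.

Definition residue (c : congruence) : int := c.1.
Definition modulus (c : congruence) : nat := c.2.

Definition satisfies (x : int) (c : congruence) : bool :=
  (x == residue c %[mod (modulus c)%:Z])%Z.

(* (r, m) and (r', m) with r = r' mod m are the same congruence, hence the
   reduction of the residues before testing for repetitions. *)
Definition distinct_congruences (s : seq congruence) : bool :=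
  uniq [seq ((residue c %% (modulus c)%:Z)%Z, modulus c) | c <- s].

Definition covering_system (s : seq congruence) : Prop :=
  all (fun c => 0 < modulus c) s /\ forall x : int, has (satisfies x) s.

(* Main.v *)
(**
  The modulus 3 takes the class 1, the three moduli 9 take the classes 2, 5, 8
  mod 9, and there remain the integers z divisible by 3. For a prime p write
  z = u p^v with p not dividing u; the digit of z at p is u mod p, one of
  1, ..., p - 1. A congruence z = a p^(e-1) mod p^e says that v = e - 1 and that
  the digit at p is a, so the family of these congruences for e = 1, ..., 23
  catches the whole digit class a, unless p^23 divides z. A finite covering of
  the box of digit tuples at 3, 5, 7, 11, 13, 17, 19 therefore lifts to a
  covering of those z that are not divisible by any p^23. In that finite
  covering each set S of primes >= 5 may be used three times, according to
  whether the exponent of 3 is 0 (no condition), 1 (the condition 3 | z, which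
  is free) or at least 2 (the digit at 3 is prescribed).

  If p^23 divides z, the moduli 23 p^e with 1 <= e <= 23 suffice: the congruence
  z = 0 mod p^e holds for all of them, and e runs over all residues mod 23.

  Every divisor of (3 * 5 * ... * 19 * 23)^23 other than 1 and 9 is used once as
  a modulus; on the divisors that play no role the residue is arbitrary.
*)
Require Import Defs.
From mathcomp Require Import all_boot all_order all_algebra.
From mathcomp Require Import zify.

Set Implicit Arguments.
Unset Strict Implicit.
Unset Printing Implicit Defensive.

Import GRing.Theory.

(** * The finite covering of the box of digit tuples *)

Definition small_primes : seq nat := [:: 3; 5; 7; 11; 13; 17; 19].
Definition all_primes : seq nat := rcons small_primes 23.

(* A computer search found these rows. The entry a at p in
   (3, 5, 7, 11, 13, 17, 19) means: 0, the modulus is prime to p; 3 at p = 3, the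
   exponent of 3 is 1; otherwise the digit at p is a. *)
Definition rows : seq (seq nat) :=
  [:: [:: 0; 1; 0; 0; 0; 0; 0];  [:: 3; 2; 0; 0; 0; 0; 0];  [:: 1; 3; 0; 0; 0; 0; 0];
      [:: 0; 0; 6; 0; 0; 0; 0];  [:: 3; 0; 2; 0; 0; 0; 0];  [:: 2; 0; 3; 0; 0; 0; 0];
      [:: 0; 4; 5; 0; 0; 0; 0];  [:: 3; 4; 4; 0; 0; 0; 0];  [:: 1; 4; 3; 0; 0; 0; 0];
      [:: 0; 0; 0; 1; 0; 0; 0];  [:: 3; 0; 0; 2; 0; 0; 0];  [:: 2; 0; 0; 3; 0; 0; 0];
      [:: 0; 3; 0; 5; 0; 0; 0];  [:: 3; 3; 0; 7; 0; 0; 0];  [:: 2; 3; 0; 8; 0; 0; 0];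
      [:: 0; 0; 1; 4; 0; 0; 0];  [:: 3; 0; 1; 6; 0; 0; 0];  [:: 2; 0; 1; 9; 0; 0; 0];
      [:: 0; 4; 1; 5; 0; 0; 0];  [:: 3; 4; 1; 7; 0; 0; 0];  [:: 1; 4; 1; 3; 0; 0; 0];
      [:: 0; 0; 0; 0; 7; 0; 0];  [:: 3; 0; 0; 0; 10; 0; 0];  [:: 2; 0; 0; 0; 11; 0; 0];
      [:: 0; 3; 0; 0; 6; 0; 0];  [:: 3; 3; 0; 0; 12; 0; 0];  [:: 2; 3; 0; 0; 4; 0; 0];
      [:: 0; 0; 5; 0; 8; 0; 0];  [:: 3; 0; 5; 0; 5; 0; 0];  [:: 2; 0; 4; 0; 9; 0; 0];
      [:: 0; 3; 4; 0; 5; 0; 0];  [:: 3; 3; 5; 0; 9; 0; 0];  [:: 2; 3; 4; 0; 8; 0; 0];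
      [:: 0; 0; 0; 10; 1; 0; 0];  [:: 3; 0; 0; 10; 3; 0; 0];  [:: 2; 0; 0; 6; 3; 0; 0];
      [:: 0; 3; 0; 4; 1; 0; 0];  [:: 3; 3; 0; 4; 3; 0; 0];  [:: 2; 3; 0; 6; 1; 0; 0];
      [:: 0; 0; 1; 10; 5; 0; 0];  [:: 3; 0; 1; 10; 9; 0; 0];  [:: 2; 0; 1; 10; 8; 0; 0];
      [:: 0; 4; 1; 10; 6; 0; 0];  [:: 3; 4; 1; 10; 12; 0; 0];  [:: 2; 3; 4; 9; 1; 0; 0];
      [:: 0; 0; 0; 0; 0; 1; 0];  [:: 3; 0; 0; 0; 0; 2; 0];  [:: 1; 0; 0; 0; 0; 9; 0];
      [:: 0; 4; 0; 0; 0; 5; 0];  [:: 3; 4; 0; 0; 0; 7; 0];  [:: 1; 4; 0; 0; 0; 11; 0];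
      [:: 0; 0; 1; 0; 0; 3; 0];  [:: 3; 0; 1; 0; 0; 4; 0];  [:: 1; 0; 1; 0; 0; 10; 0];
      [:: 0; 4; 1; 0; 0; 6; 0];  [:: 3; 4; 1; 0; 0; 8; 0];  [:: 1; 4; 1; 0; 0; 12; 0];
      [:: 0; 0; 0; 8; 0; 13; 0];  [:: 3; 0; 0; 9; 0; 13; 0];  [:: 2; 0; 0; 8; 0; 12; 0];
      [:: 0; 4; 0; 8; 0; 15; 0];  [:: 3; 4; 0; 8; 0; 10; 0];  [:: 1; 4; 0; 9; 0; 15; 0];
      [:: 0; 0; 1; 8; 0; 14; 0];  [:: 3; 0; 1; 9; 0; 16; 0];  [:: 1; 0; 1; 9; 0; 14; 0];
      [:: 0; 4; 1; 8; 0; 16; 0];  [:: 3; 4; 1; 8; 0; 11; 0];  [:: 2; 4; 1; 8; 0; 9; 0];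
      [:: 0; 0; 0; 0; 2; 14; 0];  [:: 3; 0; 0; 0; 2; 15; 0];  [:: 2; 0; 0; 0; 2; 9; 0];
      [:: 0; 3; 0; 0; 2; 6; 0];  [:: 3; 3; 0; 0; 2; 5; 0];  [:: 2; 3; 0; 0; 2; 7; 0];
      [:: 0; 0; 4; 0; 2; 3; 0];  [:: 3; 0; 4; 0; 2; 4; 0];  [:: 2; 0; 4; 0; 2; 8; 0];
      [:: 0; 3; 4; 0; 2; 10; 0];  [:: 3; 3; 4; 0; 2; 12; 0];  [:: 2; 3; 4; 0; 2; 13; 0];
      [:: 0; 0; 0; 10; 2; 13; 0];  [:: 3; 0; 0; 10; 2; 10; 0];  [:: 2; 0; 0; 10; 2; 11; 0];
      [:: 0; 3; 0; 10; 2; 8; 0];  [:: 2; 3; 0; 6; 2; 11; 0];  [:: 3; 0; 1; 10; 4; 15; 0];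
      [:: 2; 0; 1; 10; 2; 12; 0];  [:: 0; 4; 1; 10; 8; 15; 0];  [:: 3; 4; 1; 10; 4; 14; 0];
      [:: 1; 4; 1; 10; 11; 14; 0];  [:: 0; 0; 0; 0; 0; 0; 1];  [:: 3; 0; 0; 0; 0; 0; 2];
      [:: 2; 0; 0; 0; 0; 0; 3];  [:: 0; 3; 0; 0; 0; 0; 4];  [:: 3; 3; 0; 0; 0; 0; 5];
      [:: 2; 3; 0; 0; 0; 0; 6];  [:: 0; 0; 5; 0; 0; 0; 7];  [:: 3; 0; 1; 0; 0; 0; 12];
      [:: 2; 0; 5; 0; 0; 0; 12];  [:: 0; 3; 5; 0; 0; 0; 13];  [:: 3; 3; 5; 0; 0; 0; 9];
      [:: 2; 3; 5; 0; 0; 0; 15];  [:: 0; 0; 0; 10; 0; 0; 4];  [:: 3; 0; 0; 9; 0; 0; 8];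
      [:: 2; 0; 0; 9; 0; 0; 17];  [:: 0; 3; 0; 9; 0; 0; 14];  [:: 3; 3; 0; 9; 0; 0; 11];
      [:: 2; 3; 0; 9; 0; 0; 10];  [:: 0; 0; 1; 10; 0; 0; 17];  [:: 3; 0; 1; 10; 0; 0; 13];
      [:: 2; 0; 5; 9; 0; 0; 18];  [:: 0; 4; 1; 10; 0; 0; 5];  [:: 3; 4; 1; 10; 0; 0; 16];
      [:: 1; 4; 1; 10; 0; 0; 9];  [:: 0; 0; 0; 0; 2; 0; 10];  [:: 3; 0; 0; 0; 2; 0; 11];
      [:: 2; 0; 0; 0; 2; 0; 16];  [:: 0; 3; 0; 0; 2; 0; 18];  [:: 3; 3; 0; 0; 3; 0; 13];
      [:: 2; 3; 0; 0; 2; 0; 17];  [:: 0; 0; 1; 0; 4; 0; 10];  [:: 3; 0; 1; 0; 4; 0; 11];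
      [:: 2; 0; 1; 0; 4; 0; 15];  [:: 0; 4; 1; 0; 4; 0; 8];  [:: 3; 3; 5; 0; 2; 0; 14];
      [:: 2; 3; 5; 0; 2; 0; 8];  [:: 0; 0; 0; 9; 3; 0; 16];  [:: 3; 0; 0; 10; 4; 0; 18];
      [:: 2; 0; 0; 10; 4; 0; 6];  [:: 0; 3; 0; 9; 3; 0; 12];  [:: 3; 3; 0; 9; 3; 0; 15];
      [:: 2; 3; 0; 9; 3; 0; 7];  [:: 0; 0; 5; 9; 1; 0; 16];  [:: 3; 0; 1; 10; 4; 0; 7];
      [:: 2; 0; 1; 10; 4; 0; 14];  [:: 0; 4; 1; 10; 4; 0; 9];  [:: 3; 3; 4; 9; 3; 0; 18];
      [:: 2; 3; 4; 9; 3; 0; 9];  [:: 0; 0; 0; 0; 0; 16; 7];  [:: 3; 0; 0; 0; 0; 16; 14];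
      [:: 1; 0; 0; 0; 0; 15; 6];  [:: 0; 3; 0; 0; 0; 11; 7];  [:: 3; 4; 0; 0; 0; 16; 6];
      [:: 1; 4; 0; 0; 0; 13; 10];  [:: 0; 0; 1; 0; 0; 16; 10];  [:: 3; 0; 1; 0; 0; 13; 6];
      [:: 2; 0; 4; 0; 0; 11; 9];  [:: 0; 4; 1; 0; 0; 16; 18];  [:: 3; 4; 1; 0; 0; 13; 8];
      [:: 2; 3; 4; 0; 0; 16; 8];  [:: 0; 0; 0; 10; 0; 15; 11];  [:: 3; 0; 0; 10; 0; 16; 15];
      [:: 1; 0; 0; 10; 0; 16; 11];  [:: 0; 4; 0; 10; 0; 15; 15];  [:: 3; 4; 0; 10; 0; 16; 3];
      [:: 1; 4; 0; 10; 0; 13; 14];  [:: 0; 0; 1; 10; 0; 16; 8];  [:: 3; 0; 1; 10; 0; 13; 3];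
      [:: 1; 0; 1; 10; 0; 13; 11];  [:: 0; 4; 1; 10; 0; 13; 18];  [:: 3; 4; 1; 10; 0; 13; 7];
      [:: 1; 4; 1; 10; 0; 13; 15];  [:: 0; 0; 0; 0; 2; 16; 13];  [:: 3; 0; 0; 0; 2; 11; 12];
      [:: 2; 0; 0; 0; 2; 16; 9];  [:: 0; 3; 0; 0; 2; 11; 13];  [:: 3; 4; 0; 0; 11; 15; 18];
      [:: 1; 4; 0; 0; 8; 14; 3];  [:: 0; 0; 1; 0; 8; 14; 8];  [:: 3; 0; 4; 0; 2; 16; 12];
      [:: 2; 0; 4; 0; 2; 11; 15];  [:: 0; 3; 4; 0; 2; 11; 8];  [:: 3; 4; 1; 0; 11; 15; 10];
      [:: 2; 3; 4; 0; 2; 16; 15];  [:: 0; 0; 0; 10; 8; 14; 11];  [:: 3; 0; 0; 10; 11; 15; 8];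
      [:: 1; 0; 0; 10; 8; 14; 15];  [:: 0; 4; 0; 10; 8; 14; 14];  [:: 3; 4; 0; 10; 8; 14; 6];
      [:: 1; 4; 0; 10; 11; 15; 14];  [:: 0; 0; 4; 4; 2; 11; 14];  [:: 3; 0; 1; 10; 11; 15; 3];
      [:: 1; 0; 1; 10; 8; 14; 18];  [:: 0; 4; 1; 10; 11; 15; 7];  [:: 3; 4; 1; 10; 8; 14; 7];
      [:: 1; 4; 1; 10; 8; 14; 10]].

(** The case [a == p] serves the entry 3 at the prime 3: exponent 1 only asks for 3 | z and tests no
    digit. *)
Definition compatible (p d a : nat) : bool := [|| a == 0, a == p | a == d].

(* [if] instead of [||]: call-by-value evaluation would explore the whole tree. *)
Fixpoint covers (ps : seq nat) (rs : seq (seq nat)) : bool :=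
  if has (all (pred1 0)) rs then true else
  if ps is p :: ps' then
    all (fun d => covers ps' [seq behead r | r <- rs & compatible p d (head 0 r)])
        (iota 1 p.-1)
  else false.

Lemma coversP (ps : seq nat) (rs : seq (seq nat)) (digit : nat -> nat) :
    covers ps rs -> all (fun r => size r == size ps) rs ->
    {in ps, forall p, 0 < digit p < p} ->
  exists2 r, r \in rs &
    {in ps, forall p, compatible p (digit p) (nth 0 r (index p ps))}.
Proof.
move=> cov sz dig.
(* Matching by position with [zip] passes to the tail of [ps], so the induction follows one branch
   of the digit tree. *)
suff [r rs_r match_r] : exists2 r, r \in rs &
    all (fun pa => compatible pa.1 (digit pa.1) pa.2) (zip ps r).
  exists r => // p ps_p; have sz_r := eqP (allP sz r rs_r).
  apply: (allP match_r (p, _)); rewrite -{1}(nth_index 0 ps_p) -nth_zip //.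
  by rewrite mem_nth // size_zip sz_r minnn index_mem.
move: cov sz dig; have zeros_match qs r : all (pred1 0) r ->
    all (fun pa => compatible pa.1 (digit pa.1) pa.2) (zip qs r).
  elim: r qs => [|a r IHr] [|q qs] //= /andP[/eqP-> r0].
  by rewrite /compatible eqxx /=; apply: IHr.
elim: ps rs => [|p ps IHps] rs /=.
  by case: hasP => // -[r rs_r r0] _ _ _; exists r => //; apply: (zeros_match [::]).
case: ifP => [/hasP[r rs_r r0] _ _ _|_]; first by exists r => //; apply: zeros_match.
move=> /allP cov /allP sz dig.
have /andP[d_gt0 d_lt] := dig p (mem_head _ _).
have /cov : digit p \in iota 1 p.-1 by rewrite mem_iota; lia.
case/IHps => [|q ps_q|r].
- apply/allP=> x /mapP[r]; rewrite mem_filter => /andP[_ /sz sz_r] ->.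
  by rewrite size_behead (eqP sz_r).
- by apply: dig; rewrite inE ps_q orbT.
case/mapP=> r0; rewrite mem_filter => /andP[comp rs_r0] -> match_r.
exists r0 => //; have := sz _ rs_r0.
by case: r0 comp match_r {rs_r0} => //= a r0 -> ->.
Qed.

(** * From a modulus to its row and its residue *)

Definition exponent_class (p e : nat) : nat := minn e (1 + (p == 3)).

(** The exponent class of the moduli built from entry [a]. At 3 the classes are 0, 1 and at least 2;
    at other primes, zero and positive. *)
Definition entry_class (p a : nat) : nat :=
  if a == 0 then 0 else if (p == 3) && (a != 3) then 2 else 1.

Definition entry (r : seq nat) (p : nat) : nat := nth 0 r (index p small_primes).

Definition pattern (r : seq nat) : seq nat :=
  [seq entry_class p (entry r p) | p <- small_primes].

(** A modulus whose pattern is not in the table gets the row [[::]], whose entries all default to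
    0. *)
Definition row_of (m : nat) : seq nat :=
  nth [::] rows (index [seq exponent_class p (logn p m) | p <- small_primes]
                       [seq pattern r | r <- rows]).

(* The row of a modulus is found from its exponents alone; hence two rows must
   never share a pattern (pattern_uniq). With the row value 3 at p = 3 the last
   formula gives 3, i.e. the residue 0 mod 3. *)
Definition local_residue (m p : nat) : nat :=
  if m == 3 then 1
  else if 23 %| m then
    if p == 23 then \sum_(l <- small_primes) logn l m else 0
  else entry (row_of m) p * p ^ (logn p m).-1.

(* The first residue in [0, m) with the prescribed local residues: its existence
   is only needed when some z has these local residues, so the Chinese remainder
   theorem is not used. *)
Definition residue_for (m : nat) : nat :=
  find (fun r => all (fun p => r == local_residue m p %[mod p ^ logn p m]) (primes m))
       (iota 0 m).

Lemma eqn_mod_parts (m a b : nat) : 0 < m ->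
    {in primes m, forall p, a = b %[mod p ^ logn p m]} ->
  (* The order [b <= a] comes first because subtraction truncates; then m | a - b is tested on
     prime-power parts. *)
  a = b %[mod m].
Proof.
move=> m_gt0; wlog le_ba : a b / b <= a => [wlog_le eq_ab|eq_ab].
  case/orP: (leq_total b a) => [/wlog_le|/wlog_le le_ab]; first exact.
  by apply/esym/le_ab => p /eq_ab.
apply/eqP; rewrite eqn_mod_dvd //; apply/dvdn_partP => // p p_m.
by rewrite p_part -eqn_mod_dvd //; apply/eqP/eq_ab.
Qed.

Lemma residue_forP (m z : nat) : 0 < m ->
    {in primes m, forall p, z = local_residue m p %[mod p ^ logn p m]} ->
  z = residue_for m %[mod m].
Proof.
move=> m_gt0 z_loc.
set P := fun r => all (fun p => r == local_residue m p %[mod p ^ logn p m]) (primes m).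
have has_P : has P (iota 0 m).
  (* The search succeeds because z mod m itself has the local residues. *)
  apply/hasP; exists (z %% m); first by rewrite mem_iota ltn_mod.
  by apply/allP => p p_m; rewrite modn_dvdm ?pfactor_dvdnn // z_loc.
have := nth_find 0 has_P; rewrite nth_iota ?add0n; last by rewrite -[m in _ < m](size_iota 0) -has_find.
move/allP=> r_loc; apply: eqn_mod_parts => // p p_m.
by rewrite z_loc //; apply/esym/eqP/r_loc.
Qed.

(** * Products of prime powers and the common multiple of the moduli *)

Lemma prime_all_primes : {in all_primes, forall p, prime p}.
Proof. by apply/allP. Qed.

Lemma prod_prime_powers_gt0 (f : nat -> nat) (ps : seq nat) :
  {in ps, forall p, prime p} -> 0 < \prod_(p <- ps) p ^ f p.
Proof.
move=> ps_pr; rewrite big_seq prodn_cond_gt0 // => p /ps_pr p_pr.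
by rewrite expn_gt0 prime_gt0.
Qed.

Lemma logn_prod_prime_powers (f : nat -> nat) (ps : seq nat) (p : nat) :
    uniq ps -> {in ps, forall q, prime q} -> prime p ->
  logn p (\prod_(q <- ps) q ^ f q) = if p \in ps then f p else 0.
Proof.
move=> + + p_pr; elim: ps => [|r rs IHrs] /=; first by rewrite big_nil logn1.
move=> /andP[r_rs rs_uniq] rs_pr.
have r_pr : prime r by apply: rs_pr; rewrite mem_head.
have rs_pr' : {in rs, forall q, prime q}.
  by move=> q rs_q; apply: rs_pr; rewrite inE rs_q orbT.
rewrite big_cons lognM ?prod_prime_powers_gt0 ?expn_gt0 ?prime_gt0 //.
rewrite lognX logn_prime // IHrs // inE.
by case: eqVneq => [->|_]; rewrite /= ?(negPf r_rs) ?muln1 ?addn0 ?muln0.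
Qed.

Lemma primes_prod_prime_powers (f : nat -> nat) (ps : seq nat) (p : nat) :
    uniq ps -> {in ps, forall q, prime q} ->
  p \in primes (\prod_(q <- ps) q ^ f q) -> p \in ps.
Proof.
move=> ps_uniq ps_pr p_m; have := p_m; rewrite mem_primes => /and3P[p_pr _ _].
by move: p_m; rewrite -logn_gt0 logn_prod_prime_powers //; case: (p \in ps).
Qed.

Lemma dvdn_prod_prime_powers (f g : nat -> nat) (ps : seq nat) :
    {in ps, forall p, f p <= g p} ->
  \prod_(p <- ps) p ^ f p %| \prod_(p <- ps) p ^ g p.
Proof.
move=> le_fg; rewrite big_seq [X in _ %| X]big_seq.
apply: (big_ind2 (fun a b => a %| b)) => // [a b c d|p /le_fg le_p].
  exact: dvdn_mul.
exact: dvdn_exp2l.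
Qed.

Definition bound : nat := \prod_(p <- all_primes) p ^ 23.

Lemma bound_gt0 : 0 < bound.
Proof. exact: (prod_prime_powers_gt0 (fun=> 23) prime_all_primes). Qed.

Lemma dvdn_bound (p e : nat) : p \in all_primes -> e <= 23 -> p ^ e %| bound.
Proof.
by move=> p_all e_le; rewrite /bound (big_rem p) //= dvdn_mulr // dvdn_exp2l.
Qed.

Lemma odd_bound : odd bound.
Proof.
rewrite /bound big_seq; elim/big_ind: _ => // [a b|p p_all].
  by rewrite oddM => -> ->.
rewrite oddX; apply/orP; right.
by move: p p_all; apply/allP.
Qed.

(** * Properties of the table checked by computation *)

Lemma rows_cover : covers small_primes rows.
Proof. by vm_compute. Qed.

(** A nonzero entry at some p >= 5 keeps the modulus away from 1, 3 and 9; entries below p leave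
    [a == p] to the prime 3. *)
Lemma rows_wf : all (fun r => [&& size r == size small_primes,
    has (fun p => entry r p != 0) (behead small_primes)
  & all (fun p => entry r p < p) (behead small_primes)]) rows.
Proof. by vm_compute. Qed.

Lemma pattern_uniq : uniq [seq pattern r | r <- rows].
Proof. by vm_compute. Qed.

(** * The lowest nonzero digit of z in base p *)

Definition unit_digit (z p : nat) : nat := (z %/ p ^ logn p z) %% p.

Lemma unit_digit_bounds (z p : nat) : 0 < z -> prime p -> 0 < unit_digit z p < p.
Proof.
move=> z_gt0 p_pr; apply/andP; split; last by rewrite ltn_mod prime_gt0.
rewrite lt0n.
apply/negP => p_u; have : p ^ (logn p z).+1 %| z.
  by have := dvdn_mul p_u (dvdnn (p ^ logn p z)); rewrite divnK ?pfactor_dvdnn // expnS.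
by rewrite pfactor_dvdn // ltnn.
Qed.

Lemma unit_digit_mod (z p : nat) :
  z = unit_digit z p * p ^ logn p z %[mod p ^ (logn p z).+1].
Proof.
rewrite /unit_digit muln_modl expnS modn_mod divnK //.
exact: pfactor_dvdnn.
Qed.

(** * Covering the natural numbers outside the class 2 mod 3 *)

Lemma prime_power_product (f : nat -> nat) (m := \prod_(p <- all_primes) p ^ f p) :
    {in all_primes, forall p, f p <= 23} ->
  [/\ 0 < m, m %| bound, {in all_primes, forall p, logn p m = f p}
    & {in primes m, forall p, p \in all_primes}].
Proof.
move=> f_le; split=> [||p p_all|p].
- exact: prod_prime_powers_gt0 prime_all_primes.
- exact: dvdn_prod_prime_powers.
- by rewrite logn_prod_prime_powers ?p_all //; apply: prime_all_primes.
- exact: primes_prod_prime_powers prime_all_primes.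
Qed.

Lemma covered_of_bounded_valuation (z : nat) :
    3 %| z -> {in small_primes, forall p, ~~ (p ^ 23 %| z)} ->
  exists2 m, [&& m %| bound, m != 1 & m != 9] & z = residue_for m %[mod m].
Proof.
move=> z3 z_tail.
have z_gt0 : 0 < z by rewrite lt0n; apply: contraNneq (z_tail 3 isT) => ->.
have small_all p : p \in small_primes -> p \in all_primes.
  by rewrite mem_rcons inE => ->; rewrite orbT.
have pr_small p : p \in small_primes -> prime p.
  by move=> /small_all; apply: prime_all_primes.
have [||r rows_r r_z] := coversP (digit := unit_digit z) rows_cover.
- by apply: sub_all rows_wf => r /and3P[].
- by move=> p /pr_small; apply: unit_digit_bounds.
have /and3P[/eqP sz_r r_nz r_lt] := allP rows_wf r rows_r.
(* The matching row dictates the exponents; a prescribed digit sits just above p^v, hence the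
   exponent v + 1. *)
pose f p := if entry r p == 0 then 0 else if entry r p == p then 1 else (logn p z).+1.
pose m := \prod_(p <- all_primes) p ^ f p.
(* The position of 23 lies beyond the row, so the default 0 keeps 23 out of the modulus. *)
have r23 : entry r 23 = 0 by rewrite /entry nth_default // sz_r.
have [|m_gt0 m_bound logn_m primes_m] := @prime_power_product f.
  move=> p; rewrite mem_rcons inE /f => /orP[/eqP->|p_s]; first by rewrite r23.
  case: eqP => // _; case: eqP => // _.
  by have := z_tail p p_s; rewrite pfactor_dvdn ?pr_small // -ltnNge.
rewrite -/m in m_gt0 m_bound logn_m primes_m.
have [q q_s rq] := hasP r_nz.
have q_small : q \in small_primes by apply: mem_behead.
have q_m : q %| m.
  have : 0 < logn q m by rewrite logn_m ?small_all // /f (negPf rq); case: eqP.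
  by rewrite logn_gt0 mem_primes => /and3P[].
have m_neq d : ~~ has (fun p => p %| d) (behead small_primes) -> m != d.
  by move=> /hasPn no_d; apply: contraNneq (no_d q q_s) => <-.
have r_wild p : p \in small_primes -> entry r p = p -> p = 3.
  rewrite inE => /orP[/eqP //|/(allP r_lt)] /[swap] ->.
  by rewrite ltnn.
have row_m : row_of m = r.
  rewrite /row_of.
  have -> : [seq exponent_class p (logn p m) | p <- small_primes] = pattern r.
    apply/eq_in_map => p p_s; rewrite logn_m ?small_all // /f /entry_class /exponent_class.
    case: eqP => // _; case: eqP => [p_r|p_r].
      by rewrite p_r (r_wild p p_s p_r).
    case: eqP p_r => [->|_ _]; last by rewrite minnSS minn0.
    (* Since 3 | z, a prescribed digit at 3 gives exponent at least 2, so it is not confused with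
       the free exponent 1. *)
    have v_gt0 : 0 < logn 3 z by rewrite logn_gt0 mem_primes z_gt0.
    by move=> /eqP->; apply/minn_idPr.
  (* As patterns are distinct, looking up that of [r] returns [r] itself. *)
  have -> : pattern r = nth [::] [seq pattern r' | r' <- rows] (index r rows).
    by rewrite (nth_map [::]) ?index_mem // nth_index.
  by rewrite index_uniq ?size_map ?index_mem ?pattern_uniq // nth_index.
exists m; first by rewrite m_bound !m_neq.
apply: residue_forP => // p p_m; rewrite /local_residue row_m (negPf (m_neq 3 isT)).
have m23 : 23 %| m = false.
  apply/negP => d23; have : 0 < logn 23 m by rewrite logn_gt0 mem_primes m_gt0.
  by rewrite logn_m // /f r23.
have f_gt0 : 0 < f p by rewrite -logn_m ?primes_m // logn_gt0.
have p_s : p \in small_primes.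
  by have := primes_m p p_m; rewrite mem_rcons inE => /orP[/eqP p23|//]; rewrite p23 /f r23 in f_gt0.
rewrite m23 logn_m ?small_all //; move: f_gt0 (r_z p p_s); rewrite /f /compatible -/(entry r p).
case: eqP => //= _ _; case: eqP => [p_r _|_ /eqP->]; last exact: unit_digit_mod.
by rewrite p_r (r_wild p p_s p_r) muln1 expn1 modnn; apply/eqP.
Qed.

Lemma covered_of_high_valuation (z p : nat) :
    p \in small_primes -> p ^ 23 %| z ->
  exists2 m, [&& m %| bound, m != 1 & m != 9] & z = residue_for m %[mod m].
Proof.
move=> p_s p_z.
pose e := if z %% 23 == 0 then 23 else z %% 23.
have e_gt0 : 0 < e by rewrite /e lt0n; case: ifP => // ->.
have e_le : e <= 23 by rewrite /e; case: ifP => // _; rewrite ltnW // ltn_mod.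
have e_z : z = e %[mod 23] by rewrite /e; case: ifP => [/eqP->|_]; rewrite ?modn_mod.
have p_neq23 : p == 23 = false by apply: contraTF p_s => /eqP->.
have p_all : p \in all_primes by rewrite mem_rcons inE p_s orbT.
(* The modulus is 23 p^e with e congruent to z mod 23 and 1 <= e <= 23. *)
pose f l := if l == p then e else (l == 23 : nat).
have [|m_gt0 m_bound logn_m primes_m] := @prime_power_product f.
  by move=> l _; rewrite /f; case: eqP => // _; case: eqP.
set m := \prod_(l <- all_primes) l ^ f l in m_gt0 m_bound logn_m primes_m.
have m23 : 23 %| m.
  have : 0 < logn 23 m by rewrite logn_m // /f eq_sym p_neq23.
  by rewrite logn_gt0 mem_primes => /and3P[].
have m_neq d : ~~ (23 %| d) -> m != d by apply: contraNneq => <-.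
exists m; first by rewrite m_bound !m_neq.
apply: residue_forP => // l l_m.
rewrite /local_residue (negPf (m_neq 3 isT)) m23 logn_m ?primes_m //.
have : 0 < logn l m by rewrite logn_gt0.
rewrite logn_m ?primes_m // /f; case: eqP => [-> _|_].
  rewrite p_neq23 mod0n; apply/eqP.
  exact: dvdn_trans (dvdn_exp2l p e_le) p_z.
case: eqP => // -> _; rewrite expn1 (bigD1_seq p) //= logn_m // /f eqxx.
(* Among the small primes only p divides m, so the sum in [local_residue] is e, the class of z mod
   23. *)
rewrite big1_seq ?addn0 // => i /andP[i_p i_s].
rewrite logn_m; last by rewrite mem_rcons inE i_s orbT.
by rewrite /f (negPf i_p); case: eqP i_s => // ->.
Qed.

Lemma covered_by_residue_for (z : nat) : z %% 3 != 2 ->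
  exists2 m, [&& m %| bound, m != 1 & m != 9] & z = residue_for m %[mod m].
Proof.
move=> z_mod.
have [z3|z3] := boolP (3 %| z); last first.
  (* Here z is 1 mod 3, since the class 2 is left to the three moduli 9. *)
  exists 3; first by rewrite !andbT (@dvdn_bound 3 1).
  apply: residue_forP => // p; rewrite inE => /eqP->.
  rewrite /local_residue eqxx; have -> : 3 ^ logn 3 3 = 3 by [].
  by move: z_mod z3; rewrite /dvdn; lia.
have [/hasP[p p_s p_z]|/hasPn z_tail] := boolP (has (fun p => p ^ 23 %| z) small_primes).
  exact: covered_of_high_valuation p_z.
exact: covered_of_bounded_valuation.
Qed.

(** * Passing to the integers and adding the three moduli 9 *)

Lemma covering_system_of_residues (D : seq nat) (res : nat -> nat) (n : nat) :
    uniq D -> all odd D -> 1 \notin D -> 9 \notin D ->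
    0 < n -> 9 %| n -> all (fun m => m %| n) D ->
    (forall z, z %% 3 != 2 -> exists2 m, m \in D & z = res m %[mod m]) ->
  exists s : seq congruence,
    [/\ covering_system s,
        distinct_congruences s,
        all (fun c => odd (modulus c) && (1 < modulus c)) s,
        count (fun c => modulus c == 9) s = 3
      & uniq [seq modulus c | c <- s & modulus c != 9]].
Proof.
move=> D_uniq /allP D_odd D1 D9 n_gt0 n9 /allP D_n D_cov.
pose own : seq congruence := [seq (Posz (res m), m) | m <- D].
pose nines : seq congruence := [:: (Posz 2, 9); (Posz 5, 9); (Posz 8, 9)].
have own_mod : [seq modulus c | c <- own] = D by rewrite -map_comp map_id_in.
have own9 : all (fun c => modulus c != 9) own.
  by apply/allP => _ /mapP[m D_m ->] /=; apply: contraNneq D9 => <-.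
exists (nines ++ own); split.
- split.
    rewrite all_cat /=; apply/allP => _ /mapP[m D_m ->] /=.
    by rewrite odd_gt0 ?D_odd.
  (* All moduli divide n, so x may be replaced by its natural remainder mod n. *)
  move=> x; rewrite has_cat; pose z := `|(x %% Posz n)%Z|%N.
  have z_x m r : m %| n -> z = r %[mod m] -> satisfies x (Posz r, m).
    move=> m_n z_r; rewrite /satisfies /=.
    have z_xn : Posz z = (x %% Posz n)%Z by rewrite gez0_abs ?modz_ge0 // eqz_nat -lt0n.
    case/dvdnP: m_n => k n_km.
    have -> : x = ((x %/ Posz n)%Z * Posz k * Posz m + Posz z)%R.
      by rewrite z_xn -mulrA -PoszM -n_km -divz_eq.
    by rewrite modzMDl !modz_nat z_r.
  have [z3|/D_cov[m D_m z_m]] := eqVneq (z %% 3) 2; last first.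
    apply/orP; right; apply/hasP; exists (Posz (res m), m).
      by apply/mapP; exists m.
    by apply: z_x z_m; apply: D_n.
  (* The class 2 mod 3 splits into three classes mod 9. *)
  have : [|| z == 2 %[mod 9], z == 5 %[mod 9] | z == 8 %[mod 9]] by lia.
  by case/or3P => /eqP z9; rewrite /nines /= (z_x 9 _ n9 z9) ?orbT.
- rewrite /distinct_congruences map_cat cat_uniq; apply/and3P; split=> //.
    (* The two blocks share no congruence because only the first has modulus 9. *)
    apply/hasPn => _ /mapP[c own_c ->]; apply: contraL (allP own9 c own_c).
    by case/mapP => c9 nines_c9 [_ ->]; rewrite negbK; move: c9 nines_c9; apply/allP.
  by apply: (@map_uniq _ _ snd); rewrite -map_comp own_mod.
- rewrite all_cat /=; apply/allP => _ /mapP[m D_m ->] /=.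
  have := D_odd m D_m; case: m D_m => [|[|m]] // => [|_ ->] //.
  by rewrite (negPf D1).
- rewrite count_cat (_ : count _ own = 0) //; apply/eqP.
  by rewrite -leqn0 leqNgt -has_count -all_predC.
- by rewrite filter_cat /= (all_filterP own9) own_mod.
Qed.

Theorem theorem2p5 :
  exists s : seq congruence,
    [/\ covering_system s,
        distinct_congruences s,
        all (fun c => odd (modulus c) && (1 < modulus c)) s,
        count (fun c => modulus c == 9) s = 3
      & uniq [seq modulus c | c <- s & modulus c != 9]].
Proof.
pose D := [seq m <- divisors bound | (m != 1) && (m != 9)].
have mem_D m : (m \in D) = [&& m %| bound, m != 1 & m != 9].
  by rewrite mem_filter -dvdn_divisors ?bound_gt0 // andbC.
apply: (@covering_system_of_residues D residue_for bound).
- exact/filter_uniq/divisors_uniq.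
- by apply/allP => m; rewrite mem_D => /and3P[/dvdn_odd-> //]; apply: odd_bound.
- by rewrite mem_D andbF.
- by rewrite mem_D !andbF.
- exact: bound_gt0.
- exact: (@dvdn_bound 3 2).
- by apply/allP => m; rewrite mem_D => /and3P[].
- by move=> z /covered_by_residue_for[m m_ok z_m]; exists m; rewrite ?mem_D.
Qed.
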